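(* Assume $f\in C(\Omega)$, and let $\{\varepsilon_j\}_{j=1}^\infty$ be a sequence of positive numbers converging to $0$ as $j\to\infty$ such that for each $j$ the function $u_j\in C(\Omega)$ satisfies $$-\Delta_\infty^{\varepsilon_j}u_j\le f\quad\text{in }\Omega_{\varepsilon_j}.$$ Suppose also that there exists $u\in C(\Omega)$ such that $u_j\to u$ locally uniformly in $\Omega$ as $j\to\infty$. Then $u$ is a viscosity subsolution of $$-\Delta_\infty u\le f\quad\text{in }\Omega.$$
   Context: $\Omega\subseteq\mathbb{R}^n$ is a bounded, connected, open set, with finite diameter with respect to path distance in $\bar\Omega$. For $\delta>0$, $\Omega_\delta:=\{x\in\Omega:\operatorname{dist}(x,\partial\Omega)>\delta\}$. For $\varepsilon>0$, $x\in\Omega_\varepsilon$ and $u:\Omega\to\mathbb{R}$, $$S^+_\varepsilon u(x):=\sup_{y\in\bar B(x,\varepsilon)}\frac{u(y)-u(x)}{\varepsilon},\quad S^-_\varepsilon u(x):=\sup_{y\in\bar B(x,\varepsilon)}\frac{u(x)-u(y)}{\varepsilon},\quad \Delta_\infty^\varepsilon u(x):=\frac1\varepsilon\big(S^+_\varepsilon u(x)-S^-_\varepsilon u(x)\big),$$ where $\bar B(x,\varepsilon)$ is the closed Euclidean ball; the finite difference inequality is pointwise. For a $C^2$ function $\varphi$ near $x$, $\Delta_\infty^+\varphi(x):=|D\varphi(x)|^{-2}\langle D^2\varphi(x)D\varphi(x),D\varphi(x)\rangle$ if $D\varphi(x)\ne0$, and $\Delta_\infty^+\varphi(x):=\max\{\langle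 D^2\varphi(x)v,v\rangle:|v|=1\}$ if $D\varphi(x)=0$. An upper semicontinuous function $u$ on $\Omega$ is a viscosity subsolution of $-\Delta_\infty u\le f$ in $\Omega$ if, for every polynomial $\varphi$ of degree 2 (at most) and $x_0\in\Omega$ such that $u-\varphi$ has a strict local maximum at $x_0$, we have $-\Delta_\infty^+\varphi(x_0)\le f(x_0)$. (Equivalently, one may use all $\varphi\in C^2$ and not necessarily strict local maxima.) *)

(* Defs.v *)
From HB Require Import structures.
From mathcomp Require Import all_boot all_order all_algebra.
From mathcomp Require Import all_classical all_reals all_analysis.

Set Implicit Arguments.
Unset Strict Implicit.
Unset Printing Implicit Defensive.

Import Order.TTheory GRing.Theory Num.Theory.
Import numFieldNormedType.Exports.

Local Open Scope classical_set_scope.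
Local Open Scope ring_scope.

(* The canonical norm of 'rV[R]_n is the sup norm.  It induces the
   usual topology and the usual bounded sets of R^n, but lengths, distances
   and balls have to be taken with respect to the Euclidean norm below. *)
Section euclidean.
Context {R : realType} {n : nat}.
Implicit Types (x y v w : 'rV[R]_n) (A : set 'rV[R]_n).

Definition dotp v w : R := \sum_i v 0 i * w 0 i.

Definition enorm v : R := Num.sqrt (dotp v v).

Definition closed_eball x (r : R) : set 'rV[R]_n := [set y | enorm (y - x) <= r].

Definition bdry A : set 'rV[R]_n := closure A `\` interior A.

(* equal to +oo when A is empty *)
Definition dist_set x A : \bar R := ereal_inf [set (enorm (x - y))%:E | y in A].

Definition inner_set A (delta : R) : set 'rV[R]_n :=
  [set x | A x /\ (delta%:E < dist_set x (bdry A))%E].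

End euclidean.

Section path_distance.
Context {R : realType} {n : nat}.
Implicit Types (g : R -> 'rV[R]_n) (A : set 'rV[R]_n).

(* Length of the polygonal line inscribed in g with vertices at the times
   a = t_0 < t_1 < ... < t_k = b, where s = [:: t_1; ...; t_k]; this is the
   Euclidean analogue of [variation], which is restricted to real-valued g. *)
Definition polygon_length (a b : R) g (s : seq R) : R :=
  let F := g \o nth b (a :: s) in
  \sum_(0 <= k < size s) enorm (F k.+1 - F k).

Definition curve_length g : \bar R :=
  ereal_sup [set (polygon_length 0 1 g s)%:E | s in itv_partition 0 1].

Definition is_curve A (x y : 'rV[R]_n) g : Prop :=
  [/\ {within `[0, 1], continuous g}, g 0 = x, g 1 = y &
      g @` `[0, 1] `<=` A].

(* equal to +oo when no rectifiable curve joins x to y in A *)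
Definition path_dist A (x y : 'rV[R]_n) : \bar R :=
  ereal_inf [set curve_length g | g in is_curve A x y].

Definition path_diam A : \bar R :=
  ereal_sup [set path_dist A p.1 p.2 | p in A `*` A].

End path_distance.

Section finite_differences.
Context {R : realType} {n : nat}.
Implicit Types (eps : R) (u : 'rV[R]_n -> R) (x : 'rV[R]_n).

(* The suprema are those of bounded sets whenever u is continuous on an open
   set containing the closed ball, in particular on [inner_set Omega eps] for
   u continuous on the open set Omega. *)
Definition slope_plus eps u x : R :=
  sup [set (u y - u x) / eps | y in closed_eball x eps].

Definition slope_minus eps u x : R :=
  sup [set (u x - u y) / eps | y in closed_eball x eps].

Definition fd_inf_laplacian eps u x : R :=
  eps^-1 * (slope_plus eps u x - slope_minus eps u x).

End finite_differences.

Section viscosity.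
Context {R : realType} {n : nat}.
Implicit Types (phi u f : 'rV[R]_n -> R) (x v : 'rV[R]_n).
Implicit Types (Omega : set 'rV[R]_n).

Definition unit_vec (i : 'I_n) : 'rV[R]_n := delta_mx 0 i.

Definition gradient phi x : 'rV[R]_n := \row_i 'D_(unit_vec i) phi x.

Definition hessian phi x : 'M[R]_n :=
  \matrix_(i, j) 'D_(unit_vec i) (fun y => 'D_(unit_vec j) phi y) x.

(* <H v, v>; with row vectors, H v is v *m H^T *)
Definition quad_form (H : 'M[R]_n) v : R := dotp (v *m H^T) v.

(* In the second case the supremum is that of a continuous function on the
   unit sphere, which is compact (and nonempty for 0 < n): it is a maximum. *)
Definition inf_laplacian_plus phi x : R :=
  if gradient phi x != 0 then
    (enorm (gradient phi x) ^+ 2)^-1 *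
      quad_form (hessian phi x) (gradient phi x)
  else
    sup [set quad_form (hessian phi x) v | v in [set v | enorm v = 1]].

Definition poly_deg_le2 phi : Prop :=
  exists (c : R) (b : 'rV[R]_n) (A : 'M[R]_n),
    forall x, phi x =
      c + \sum_i b 0 i * x 0 i + \sum_i \sum_j A i j * x 0 i * x 0 j.

Definition strict_local_max u x : Prop := \forall y \near x^', u y < u x.

Definition usc_on Omega u : Prop :=
  forall x, Omega x -> forall a : R, u x < a ->
    \forall y \near within Omega (nbhs x), u y < a.

Definition viscosity_subsolution Omega u f : Prop :=
  usc_on Omega u /\
  forall phi x0, poly_deg_le2 phi -> Omega x0 ->
    strict_local_max (fun y => u y - phi y) x0 ->
    - inf_laplacian_plus phi x0 <= f x0.

(* Uniform convergence on the compact subsets of Omega. *)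
Definition cvg_locally_uniformly Omega (u_ : nat -> 'rV[R]_n -> R) u : Prop :=
  forall K : set 'rV[R]_n, compact K -> K `<=` Omega ->
    {uniform K, u_ @ \oo --> u}.

End viscosity.

(* Main.v *)
Require Import Defs.
From HB Require Import structures.
From mathcomp Require Import all_boot all_order all_algebra.
From mathcomp Require Import all_classical all_reals all_analysis.
From mathcomp Require Import ring lra.

Import Order.TTheory GRing.Theory Num.Theory.
Import numFieldNormedType.Exports.

Local Open Scope classical_set_scope.
Local Open Scope ring_scope.

(** Let [phi] be a quadratic polynomial such that [u - phi] has a strict local
    maximum at [x0].  Strict maxima are stable under uniform perturbation
    ([perturbed_strict_max]), so for any [chi] uniformly close to [phi] and
    [j] large, [u_ j - chi] has a maximum over a fixed compact neighbourhood
    at some [x] close to [x0].  The maximum property bounds the increments of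
    [u_ j] around [x] by those of [chi], which gives [- C <= f x] as soon as
    [C] bounds the discrete operator applied to [chi] at [x]
    ([perturbed_test_point]).

    To bound the discrete operator it suffices to pair every step [w] of
    length at most [eps] with another such step [w'] for which the sum of the
    two increments is at most [C * eps ^+ 2] ([two_point_bound]): the best
    upward slope is then beaten, up to [C * eps], by a downward slope.

    If the gradient of [phi] does not vanish at [x0], take [chi = phi] and let
    [p] be its gradient at the touching point [x].  Then [w' = - eps p / |p|]
    suits all [w], with an error of order [eps / |p|]
    ([two_point_bound_taylor]).

    If the gradient vanishes at [x0], then [phi] lies below the paraboloid
    [lam / 2 * |y - x0| ^ 2] (up to a constant), where [lam] is the supremum
    of the Hessian form on the unit sphere, so one may test with this
    paraboloid.  For [0 <= lam] the choice [w' = - w] is enough.  For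
    [lam < 0] the discrete operator is not consistent near the vertex: at the
    vertex itself its value is [lam / 2], not [lam].  At distance at least
    [eps] from the vertex, however, its value is exactly [lam].  So suppose
    that [f x0 < - lam], and test with the paraboloid whose vertex is moved to
    some [z <> x0] near [x0].  The touching points must be within [eps_ j] of
    [z], and in the limit [u x0 + |lam| / 2 * |z - x0| ^ 2 <= u z].  But [u]
    is touched from above at [x0] by a concave paraboloid with vertex [x0], so
    [u z < u x0]: a contradiction ([concave_paraboloid_test]). *)

(** * Euclidean geometry of row vectors *)

Section euclidean_space.
Context {R : realType} {n : nat}.
Implicit Types (x y z v w e d p : 'rV[R]_n) (H A : 'M[R]_n) (a r : R).

Lemma dotpC v w : dotp v w = dotp w v.
Proof. by apply: eq_bigr => i _; rewrite mulrC. Qed.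

Lemma dotpDl v1 v2 w : dotp (v1 + v2) w = dotp v1 w + dotp v2 w.
Proof. by rewrite -big_split; apply: eq_bigr => i _; rewrite mxE mulrDl. Qed.

Lemma dotpDr v w1 w2 : dotp v (w1 + w2) = dotp v w1 + dotp v w2.
Proof. by rewrite dotpC dotpDl !(dotpC v). Qed.

Lemma dotpZl a v w : dotp (a *: v) w = a * dotp v w.
Proof. by rewrite /dotp mulr_sumr; apply: eq_bigr => i _; rewrite mxE mulrA. Qed.

Lemma dotpZr a v w : dotp v (a *: w) = a * dotp v w.
Proof. by rewrite dotpC dotpZl dotpC. Qed.

Lemma dotpNl v w : dotp (- v) w = - dotp v w.
Proof. by rewrite -scaleN1r dotpZl mulN1r. Qed.

Lemma dotpNr v w : dotp v (- w) = - dotp v w.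
Proof. by rewrite dotpC dotpNl dotpC. Qed.

Lemma dotp0r v : dotp v 0 = 0.
Proof. by rewrite -(scale0r 0) dotpZr mul0r. Qed.

Definition dotpE := (dotpDl, dotpDr, dotpNl, dotpNr, dotpZl, dotpZr).

Lemma dotp_mulmx A v w : dotp (v *m A) w = dotp v (w *m A^T).
Proof.
have E (v' w' : 'rV[R]_n) : dotp v' w' = (v' *m w'^T) 0 0.
  by rewrite mxE; apply: eq_bigr => i _; rewrite mxE.
by rewrite !E trmx_mul trmxK mulmxA.
Qed.

Lemma dotp_unit_vec v (i : 'I_n) : dotp v (unit_vec i) = v 0 i.
Proof.
rewrite /dotp (bigD1 i)//= big1 => [|k ki]; rewrite /unit_vec mxE eqxx/=.
  by rewrite eqxx mulr1 addr0.
by rewrite (negbTE ki) mulr0.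
Qed.

Lemma quad_formZ H a v : quad_form H (a *: v) = a ^+ 2 * quad_form H v.
Proof. by rewrite /quad_form -scalemxAl !dotpE expr2 mulrA. Qed.

Lemma quad_formE H v : quad_form H v = \sum_i \sum_j H i j * (v 0 i * v 0 j).
Proof.
rewrite /quad_form /dotp; apply: eq_bigr => i _; rewrite mxE mulr_suml.
by apply: eq_bigr => j _; rewrite mxE; ring.
Qed.

Lemma dotp_ge0 v : 0 <= dotp v v.
Proof. by apply: sumr_ge0 => i _; rewrite -expr2 sqr_ge0. Qed.

Lemma enorm_ge0 v : 0 <= enorm v.
Proof. exact: sqrtr_ge0. Qed.

Lemma sqr_enorm v : enorm v ^+ 2 = dotp v v.
Proof. by rewrite sqr_sqrtr// dotp_ge0. Qed.

Lemma enormZ a v : enorm (a *: v) = `|a| * enorm v.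
Proof. by rewrite /enorm !dotpE mulrA -expr2 sqrtrM ?sqr_ge0// sqrtr_sqr. Qed.

Lemma enormN v : enorm (- v) = enorm v.
Proof. by rewrite -scaleN1r enormZ normrN normr1 mul1r. Qed.

Lemma enormB v w : enorm (v - w) = enorm (w - v).
Proof. by rewrite -enormN opprB. Qed.

Lemma enorm0 : enorm (0 : 'rV[R]_n) = 0.
Proof. by rewrite /enorm dotp0r sqrtr0. Qed.

Lemma coord_le_enorm v i : `|v 0 i| <= enorm v.
Proof.
rewrite -(@ler_sqr _ _ _ (normr_ge0 _) (enorm_ge0 v)) sqr_enorm real_normK ?num_real//.
rewrite /dotp (bigD1 i)//= -expr2 lerDl.
by apply: sumr_ge0 => k _; rewrite -expr2 sqr_ge0.
Qed.

(** Turns Euclidean smallness into smallness for the topology of ['rV[R]_n],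
    whose norm is the sup norm. *)
Lemma norm_le_enorm v : `|v| <= enorm v.
Proof.
rewrite [`|v|]mx_normrE; apply: bigmax_le; first exact: enorm_ge0.
by move=> [i j] _ /=; rewrite ord1 coord_le_enorm.
Qed.

Lemma enorm_eq0 v : (enorm v == 0) = (v == 0).
Proof.
apply/idP/eqP => [/eqP v0|->]; last by rewrite enorm0.
by apply/eqP; rewrite -normr_le0 (le_trans (norm_le_enorm v))// v0.
Qed.

Lemma enorm_gt0 v : (0 < enorm v) = (v != 0).
Proof. by rewrite lt0r enorm_eq0 enorm_ge0 andbT. Qed.

Lemma enorm_normalize v : v != 0 -> enorm ((enorm v)^-1 *: v) = 1.
Proof.
rewrite -enorm_gt0 => v0.
by rewrite enormZ ger0_norm ?invr_ge0 ?enorm_ge0// mulVf// gt_eqF.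
Qed.

Lemma quad_form_le H v :
  quad_form H v <= (\sum_i \sum_j `|H i j|) * enorm v ^+ 2.
Proof.
rewrite quad_formE mulr_suml; apply: ler_sum => i _.
rewrite mulr_suml; apply: ler_sum => j _.
rewrite (le_trans (ler_norm _))// !normrM ler_wpM2l// expr2.
by rewrite ler_pM// coord_le_enorm.
Qed.

(** Being linear in [enorm (v - w)], this is what the quadratic gain
    [dotp e v - 1 <= - enorm (v - e) ^+ 2 / 2] of [two_point_bound_taylor]
    absorbs. *)
Lemma quad_form_diff_le H v w : enorm v <= 1 -> enorm w <= 1 ->
  quad_form H v - quad_form H w <= 2 * (\sum_i \sum_j `|H i j|) * enorm (v - w).
Proof.
move=> v1 w1; rewrite !quad_formE -mulrA mulrCA mulr_suml -sumrB.
apply: ler_sum => i _; rewrite mulr_suml -sumrB; apply: ler_sum => j _.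
rewrite -mulrBr (le_trans (ler_norm _))// normrM ler_wpM2l//.
have -> : v 0 i * v 0 j - w 0 i * w 0 j =
   (v - w) 0 i * v 0 j + w 0 i * (v - w) 0 j by rewrite !mxE; ring.
rewrite (le_trans (ler_normD _ _))// !normrM mulrDl mul1r.
apply: lerD.
  by rewrite -[leRHS]mulr1 ler_pM// ?coord_le_enorm// (le_trans (coord_le_enorm _ _)).
by rewrite -[leRHS]mul1r ler_pM// ?coord_le_enorm// (le_trans (coord_le_enorm _ _)).
Qed.

(** Continuity of vector-valued maps is always expressed coordinate by
    coordinate here, which reduces it to real-valued sums and products. *)
Lemma continuous_coordwise_dotp (S : topologicalType) (f g : S -> 'rV[R]_n) :
  (forall i, continuous (fun s => f s 0 i)) ->
  (forall i, continuous (fun s => g s 0 i)) ->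
  continuous (fun s => dotp (f s) (g s)).
Proof.
move=> cf cg s; apply: cvg_big => [|i _]; first exact: add_continuous.
by apply: cvgM; [exact: cf|exact: cg].
Qed.

Lemma continuous_coordwise_enorm (S : topologicalType) (f : S -> 'rV[R]_n) :
  (forall i, continuous (fun s => f s 0 i)) -> continuous (fun s => enorm (f s)).
Proof.
move=> cf s; apply: (@continuous_comp _ _ _ (fun s => dotp (f s) (f s)) Num.sqrt).
  exact: continuous_coordwise_dotp.
exact: sqrt_continuous.
Qed.

Lemma continuous_coordwise_mulmx (S : topologicalType) A (f : S -> 'rV[R]_n) :
  (forall i, continuous (fun s => f s 0 i)) ->
  forall i, continuous (fun s => (f s *m A) 0 i).
Proof.
move=> cf i s.
under eq_fun do rewrite mxE.
apply: cvg_big => [|k _]; first exact: add_continuous.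
by apply: cvgM; [exact: cf|exact: cvg_cst].
Qed.

Lemma continuous_coordB z i : continuous (fun y : 'rV[R]_n => (y - z) 0 i).
Proof.
move=> y; under eq_fun do rewrite !mxE.
apply: (@continuousB _ _ _ (fun y : 'rV[R]_n => y 0 i) (fun=> z 0 i)).
  exact: coord_continuous.
exact: cst_continuous.
Qed.

Lemma continuous_enormB z : continuous (fun y => enorm (y - z)).
Proof. apply: continuous_coordwise_enorm => i; exact: continuous_coordB. Qed.

End euclidean_space.

(** * Quadratic polynomials *)

Section quadratic_polynomials.
Context {R : realType} {n : nat}.
Implicit Types (x y z v w b : 'rV[R]_n) (H A : 'M[R]_n) (phi : 'rV[R]_n -> R).

Lemma derive_quadratic phi x v (a b : R) :
  (forall t : R, phi (x + t *: v) = phi x + t * a + t ^+ 2 * b) ->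
  'D_v phi x = a.
Proof.
move=> phiE; rewrite /derive; apply: cvg_lim => //.
have lin : (fun t : R => a + t * b) @ 0^' --> a.
  rewrite -[X in _ --> X]addr0 -[X in _ + X](mul0r b).
  by apply: cvgD; [exact: cvg_cst|apply: cvgMr_tmp; exact: nbhs_dnbhs].
apply: cvg_trans lin; apply: near_eq_cvg.
near=> t.
have t0 : t != 0 by near: t; exact: nbhs_dnbhs_neq.
rewrite /= [_ + x]addrC phiE /GRing.scale/=; field.
exact: t0.
Unshelve. all: by end_near. Qed.

(** For [phi] of leading form given by [A], the Hessian is [A + A^T].  The
    expansion is an algebraic identity; reading it along the coordinate
    directions gives the derivatives. *)
Lemma poly_deg_le2_taylor phi : poly_deg_le2 phi ->
  exists b H, [/\ forall x, gradient phi x = b + x *m H,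
    forall x, hessian phi x = H &
    forall x w, phi (x + w) =
      phi x + dotp (b + x *m H) w + 2^-1 * quad_form H w].
Proof.
move=> [c [b [A phiA]]].
have phiE x : phi x = c + dotp b x + dotp (x *m A) x.
  rewrite phiA; congr (_ + _); rewrite dotp_mulmx /dotp; apply: eq_bigr => i _.
  by rewrite mxE mulr_sumr; apply: eq_bigr => j _; rewrite mxE; ring.
pose H := A + A^T.
have HT : H^T = H by rewrite /H linearD/= trmxK addrC.
have taylor x w : phi (x + w) =
    phi x + dotp (b + x *m H) w + 2^-1 * quad_form H w.
  rewrite !phiE /quad_form HT /H !(mulmxDl, mulmxDr) !dotpE.
  have -> : dotp (w *m A) x = dotp (x *m A^T) w by rewrite dotp_mulmx dotpC.
  have -> : dotp (w *m A^T) w = dotp (w *m A) w by rewrite dotpC -dotp_mulmx.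
  by field.
have gradE x : gradient phi x = b + x *m H.
  apply/rowP => i; rewrite mxE.
  apply: (@derive_quadratic _ _ _ _ (2^-1 * quad_form H (unit_vec i))) => t.
  by rewrite taylor quad_formZ dotpZr dotp_unit_vec; ring.
exists b, H; split=> // x.
apply/matrixP => i j; rewrite mxE.
have -> : (fun y => 'D_(unit_vec j) phi y) = (fun y => (b + y *m H) 0 j).
  by apply/funext => y; rewrite -gradE mxE.
apply: (@derive_quadratic _ _ _ _ 0) => t.
have -> : H i j = (unit_vec i *m H) 0 j by rewrite /unit_vec -rowE [RHS]mxE.
rewrite mulmxDl -scalemxAl; move: (x *m H) (unit_vec i *m H) => y1 y2.
by rewrite !mxE; ring.
Qed.

End quadratic_polynomials.

(** * Upper bounds for the discrete infinity Laplacian *)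

Section two_point_bounds.
Context {R : realType} {n : nat}.
Implicit Types (x y z v w p : 'rV[R]_n) (H : 'M[R]_n) (psi : 'rV[R]_n -> R).
Implicit Types (eps C lam : R).

(** A pointwise form of [fd_inf_laplacian eps psi x <= C] that mentions
    neither suprema nor maximizers, and that passes from [psi] to any function
    touched by [psi] from above at [x]; see [fd_inf_laplacian_le]. *)
Definition two_point_bound psi x eps C :=
  forall w, enorm w <= eps -> exists2 w', enorm w' <= eps &
    (psi (x + w) - psi x) + (psi (x + w') - psi x) <= C * eps ^+ 2.

(** With [e = p / |p|] and [w = eps v], the linear terms of the two increments
    add up to [eps |p| (<e, v> - 1) <= - eps |p| |v - e| ^ 2 / 2], since [v] lies
    in the unit ball.  Replacing [<H v, v>] by [<H e, e>] costs at most
    [eps ^ 2 M |v - e|], where [M] is the sum of the absolute values of the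
    entries of [H].  Maximizing over [|v - e|] leaves the error
    [M ^ 2 eps / (2 |p|)]. *)
Lemma two_point_bound_taylor psi x p H eps : 0 < eps -> p != 0 ->
  (forall w, psi (x + w) = psi x + dotp p w + 2^-1 * quad_form H w) ->
  two_point_bound psi x eps ((enorm p ^+ 2)^-1 * quad_form H p +
    (\sum_i \sum_j `|H i j|) ^+ 2 / (2 * enorm p) * eps).
Proof.
move=> eps0 p0 taylor w weps.
have np0 : 0 < enorm p by rewrite enorm_gt0.
set M : R := \sum_i _; set np := enorm p in np0 *.
pose e := np^-1 *: p; pose v := eps^-1 *: w.
have e1 : enorm e = 1 by exact: enorm_normalize.
have v1 : enorm v <= 1.
  by rewrite enormZ gtr0_norm ?invr_gt0// mulrC ler_pdivrMr// mul1r.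
have wE : w = eps *: v by rewrite scalerA divff ?scale1r// gt_eqF.
have pE : p = np *: e by rewrite scalerA divff ?scale1r// gt_eqF.
have He : np ^- 2 * quad_form H p = quad_form H e.
  by rewrite /e quad_formZ exprVn.
clearbody e v.
exists ((- eps) *: e); first by rewrite enormZ e1 mulr1 normrN gtr0_norm.
rewrite He !taylor wE pE !quad_formZ sqrrN !dotpE.
have ee : dotp e e = 1 by rewrite -sqr_enorm e1 expr1n.
have vv : dotp v v <= 1 by rewrite -sqr_enorm expr_le1// enorm_ge0.
have e1' : enorm e <= 1 by rewrite e1.
have := quad_form_diff_le H v e v1 e1'.
rewrite -/M; set t := enorm (v - e).
have t2 : t ^+ 2 = dotp v v - 2 * dotp e v + 1.
  by rewrite sqr_enorm !dotpE (dotpC v e) ee; ring.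
rewrite ee.
set s := dotp e v in t2 *; set qv := quad_form H v; set qe := quad_form H e.
move=> hq.
(* completing the square in [t] *)
have sq : 0 <= eps / (2 * np) * (np * t - eps * M) ^+ 2.
  by rewrite mulr_ge0 ?sqr_ge0// divr_ge0// ?mulr_ge0// ltW.
have h1 : eps * np * (s - 1) <= eps * np * (- (t ^+ 2 / 2)).
  by rewrite ler_pM2l ?mulr_gt0//; lra.
have h2 : eps ^+ 2 * (qv - qe) <= eps ^+ 2 * (2 * M * t).
  by rewrite ler_pM2l ?exprn_gt0.
have rhsE : (qe + M ^+ 2 / (2 * np) * eps) * eps ^+ 2 =
    eps ^+ 2 * qe + eps * np * (t ^+ 2 / 2) * -1 + eps ^+ 2 * M * t +
     eps / (2 * np) * (np * t - eps * M) ^+ 2.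
  by field; rewrite gt_eqF.
by rewrite rhsE; lra.
Qed.

Definition paraboloid lam z y : R := lam / 2 * enorm (y - z) ^+ 2.

Lemma paraboloid_continuous lam z : continuous (paraboloid lam z).
Proof.
move=> y; apply: (@continuousM _ _ (fun=> lam / 2) (fun y => enorm (y - z) ^+ 2)).
  exact: cst_continuous.
apply: (@continuous_comp _ _ _ (fun y => enorm (y - z)) (fun t : R => t ^+ 2)).
  exact: continuous_enormB.
exact: exprn_continuous.
Qed.

Lemma paraboloid_center lam z : paraboloid lam z z = 0.
Proof. by rewrite /paraboloid subrr enorm0 expr0n mulr0. Qed.

Lemma paraboloidD lam z x w : paraboloid lam z (x + w) - paraboloid lam z x =
  lam / 2 * (2 * dotp (x - z) w + dotp w w).
Proof.
rewrite /paraboloid !sqr_enorm addrAC; move: (x - z) => d.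
by rewrite !dotpE (dotpC w d); ring.
Qed.

(** Opposite steps cancel the linear terms and leave [lam * |w| ^ 2]. *)
Lemma two_point_bound_convex_paraboloid lam z x eps : 0 <= lam ->
  two_point_bound (paraboloid lam z) x eps lam.
Proof.
move=> lam0 w weps; exists (- w); first by rewrite enormN.
rewrite !paraboloidD !dotpE.
have ww : dotp w w <= eps ^+ 2.
  by rewrite -sqr_enorm ler_sqr// nnegrE ?enorm_ge0// (le_trans _ weps)// enorm_ge0.
have := ler_wpM2l lam0 ww.
lra.
Qed.

(** Here the second step points away from the vertex [z].  The distance
    hypothesis is sharp: when [z] is in the interior of the ball, the largest
    value of the paraboloid is taken there and not on the boundary, and the
    bound fails; for [x = z] the discrete operator equals [lam / 2]. *)
Lemma two_point_bound_concave_paraboloid lam z x eps :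
  lam < 0 -> 0 < eps -> eps <= enorm (x - z) ->
  two_point_bound (paraboloid lam z) x eps lam.
Proof.
move=> lam0 eps0 epsr w weps.
set r := enorm (x - z) in epsr.
have r0 : 0 < r by exact: lt_le_trans epsr.
pose e := r^-1 *: (x - z).
have e1 : enorm e = 1 by apply: enorm_normalize; rewrite -enorm_gt0.
have ee : dotp e e = 1 by rewrite -sqr_enorm e1 expr1n.
have xzE : x - z = r *: e by rewrite scalerA divff ?scale1r// gt_eqF.
clearbody e.
exists (eps *: e); first by rewrite enormZ e1 mulr1 gtr0_norm.
rewrite !paraboloidD xzE !dotpE ee.
have ww : dotp w w <= eps ^+ 2.
  by rewrite -sqr_enorm ler_sqr// nnegrE ?enorm_ge0// ltW.
have := dotp_ge0 (w + eps *: e); rewrite !dotpE (dotpC w e) ee.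
set s := dotp e w; set q := dotp w w in ww *.
move=> sq.
(* [0 <= |w + eps e| ^ 2] and [|w| <= eps] *)
have s0 : 0 <= s + eps.
  by rewrite -(pmulr_rge0 _ eps0); lra.
have := ler_wpM2r s0 epsr => h.
have h' : 0 <= 2 * (r * s) + q + (2 * (r * eps) + eps ^+ 2) - 2 * eps ^+ 2 by lra.
have := mulr_le0_ge0 (ltW lam0) h'.
lra.
Qed.

End two_point_bounds.

(** * Comparison with a touching function *)

Section finite_difference_comparison.
Context {R : realType} {n : nat}.
Implicit Types (x y : 'rV[R]_n) (psi v : 'rV[R]_n -> R).

(** Each upward slope of [v] is at most [C * eps] plus the downward slope
    given by the paired step.  The lower bound [m] makes the set of downward
    slopes bounded, so that its [sup] is an actual supremum. *)
Lemma fd_inf_laplacian_le v psi x (eps C m : R) : 0 < eps ->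
  (forall y, closed_eball x eps y -> m <= v y) ->
  (forall y, closed_eball x eps y -> v y - psi y <= v x - psi x) ->
  two_point_bound psi x eps C ->
  fd_inf_laplacian eps v x <= C.
Proof.
move=> eps0 vm touch psiC.
have ballE w : enorm w <= eps -> closed_eball x eps (x + w).
  by rewrite /closed_eball/= addrC addKr.
have slope_minus_ge w : enorm w <= eps -> (v x - v (x + w)) / eps <= slope_minus eps v x.
  move=> weps; apply: ub_le_sup; last by exists (x + w) => //; exact: ballE.
  exists ((v x - m) / eps) => _ [y yx <-].
  by rewrite ler_pM2r ?invr_gt0// lerD2l lerN2 vm.
rewrite /fd_inf_laplacian ler_pdivrMl// lerBlDr; apply: ge_sup.
  exists ((v x - v x) / eps), x => //.
  by rewrite /closed_eball/= subrr enorm0 ltW.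
move=> _ [y yx <-].
have [w' w'eps] := psiC _ yx.
rewrite [x + _]addrC subrK => yw'.
have := slope_minus_ge _ w'eps.
have := touch _ yx; have := touch _ (ballE _ w'eps) => t1 t2 s1.
apply: le_trans (lerD (lexx _) s1).
rewrite ler_pdivrMr// mulrDl divfK ?gt_eqF//.
have -> : eps * C * eps = C * eps ^+ 2 by ring.
lra.
Qed.

End finite_difference_comparison.

(** Away from [x0] the function [h] stays below [h x0] by a definite gap, by
    compactness, and perturbations smaller than half of the gap cannot move the
    maximum there. *)
Lemma perturbed_strict_max {R : realType} {T : topologicalType} {K V : set T}
    {h : T -> R} {x0 : T} :
  compact K -> {within K, continuous h} -> K x0 -> nbhs x0 V ->
  (forall y, K y -> y <> x0 -> h y < h x0) ->
  exists2 gamma : R, 0 < gamma & forall g : T -> R, {within K, continuous g} ->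
    (forall y, K y -> `|g y - h y| <= gamma) ->
    exists x, [/\ K x, V x & forall y, K y -> g y <= g x].
Proof.
move=> cK ch Kx0 Vx0 hmax; pose L := K `&` ~` interior V.
have argmax g : {within K, continuous g} -> exists2 x, K x & forall y, K y -> (g y : R) <= g x.
  move=> cg; have [|x xK xmax] := compact_EVT_max _ cK cg; first by exists x0.
  by exists x; [exact: set_mem|move=> y yK; apply: xmax; exact: mem_set].
have [[y0 Ly0]|L0] := pselect (L !=set0); last first.
  exists 1 => // g cg _; have [x Kx xmax] := argmax _ cg.
  exists x; split=> //; apply: contrapT => Vx; apply: L0; exists x; split=> //.
  by move=> /interior_subset.
have cL : compact L.
  by apply: compact_closedI => //; apply: open_closedC; exact: open_interior.
have chL : {within L, continuous h} by apply: continuous_subspaceW ch => y [].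
have [|c cinL cmax] := compact_EVT_max _ cL chL; first by exists y0.
have [Kc Vc] := set_mem cinL.
have gap : h c < h x0.
  by apply: hmax => // cx0; apply: Vc; rewrite cx0; exact: nbhs_singleton (nbhs_interior Vx0).
exists ((h x0 - h c) / 3) => [|g cg gh]; first by lra.
have [x Kx xmax] := argmax _ cg.
exists x; split=> //; apply: contrapT => Vx.
have Lx : L x by split=> // /interior_subset.
have := cmax _ (mem_set Lx); have := xmax _ Kx0.
have := gh _ Kx; have := gh _ Kx0.
rewrite !ler_norml => /andP[? ?] /andP[? ?] ? ?; lra.
Qed.

Lemma near_uniform_le {R : realType} {T : choiceType} {K : set T}
    {u_ : nat -> T -> R} {u : T -> R} (e : R) :
  {uniform K, u_ @ \oo --> u} -> 0 < e ->
  \forall j \near \oo, forall y, K y -> `|u_ j y - u y| <= e.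
Proof.
move=> u_u e0.
apply: (u_u [set g | forall y, K y -> `|g y - u y| <= e]).
apply/uniform_nbhs; exists [set p | ball p.1 e p.2]; split.
  exact: entourage_ball (PosNum e0).
by move=> g /= gb y Ky; have := gb y Ky; rewrite /ball/= distrC => /ltW.
Qed.

Lemma within_open_continuous_at {T U : topologicalType} {A : set T} {g : T -> U} {x} :
  open A -> {within A, continuous g} -> A x -> {for x, continuous g}.
Proof.
by move=> oA; rewrite continuous_open_subspace// => cg Ax; apply: cg; exact: mem_set.
Qed.

(** * Stability of subsolutions *)

Section stability.
Context {R : realType} {n : nat} {Omega : set 'rV[R]_n}.
Context {f : 'rV[R]_n -> R} {eps_ : nat -> R} {u_ : nat -> 'rV[R]_n -> R}.
Context {u : 'rV[R]_n -> R}.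
Context (oOmega : open Omega) (cf : {within Omega, continuous f}).
Context (eps0 : forall j, 0 < eps_ j) (epscvg : eps_ @ \oo --> (0 : R)).
Context (cu_ : forall j, {within Omega, continuous (u_ j)}).
Context (subu_ : forall j x, inner_set Omega (eps_ j) x ->
  - fd_inf_laplacian (eps_ j) (u_ j) x <= f x).
Context (cu : {within Omega, continuous u}).
Context (u_u : cvg_locally_uniformly Omega u_ u).
Implicit Types (x y z d : 'rV[R]_n) (psi chi phi : 'rV[R]_n -> R).

(** The neighbourhood [K] depends on neither [V] nor [chi]: this allows the
    caller to choose [chi] after [K], as is done when the vertex of a
    paraboloid is moved. *)
Lemma perturbed_test_point {x0 psi} : Omega x0 -> continuous psi ->
  strict_local_max (fun y => u y - psi y) x0 ->
  exists K : set 'rV[R]_n, [/\ nbhs x0 K, compact K, K `<=` Omega &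
    forall V, nbhs x0 V -> exists2 gamma : R, 0 < gamma &
      forall chi, continuous chi -> (forall y, K y -> `|chi y - psi y| <= gamma) ->
      \forall j \near \oo, exists x, [/\ K x, V x,
        forall y, K y -> u_ j y - chi y <= u_ j x - chi x &
        forall C, two_point_bound chi x (eps_ j) C -> - C <= f x]].
Proof.
move=> Ox0 cpsi umax.
have [r r0 rball] : exists2 r : R, 0 < r & forall y, ball x0 r y ->
    Omega y /\ (y <> x0 -> u y - psi y < u x0 - psi x0).
  have : \forall y \near x0, Omega y /\ (y <> x0 -> u y - psi y < u x0 - psi x0).
    near=> y; split; first by near: y; exact: open_nbhs_nbhs.
    move=> yx0; have : y != x0 by apply/eqP.
    by near: y; exact: umax.
  by move=> /nbhs_ballP[r r0 rball]; exists r.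
pose K : set 'rV[R]_n := closed_ball_ Num.norm x0 (r / 2).
have KO y : K y -> ball x0 r y.
  by rewrite -ball_normE => /le_lt_trans; apply; lra.
have KOmega : K `<=` Omega by move=> y /KO/rball[].
have cK : compact K.
  apply: bounded_closed_compact.
    exists (r / 2 + `|x0|); split; first exact: num_real.
    move=> M rM y /= Ky; rewrite -(subrK x0 y) (le_trans (ler_normD _ _))//.
    by rewrite (le_trans _ (ltW rM))// lerD2r distrC.
  exact: closed_closed_ball_.
have Kx0 : nbhs x0 K.
  apply/nbhs_ballP; exists (r / 2); first by rewrite /=; lra.
  by move=> y; rewrite -ball_normE => /ltW.
have cuK (g : 'rV[R]_n -> R) : {within Omega, continuous g} -> {within K, continuous g}.
  exact: continuous_subspaceW.
have cB (g chi : 'rV[R]_n -> R) : {within Omega, continuous g} -> continuous chi ->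
    {within K, continuous (fun y => g y - chi y)}.
  move=> /cuK cg cchi y; apply: cvgB; first exact: cg.
  by apply: continuous_subspaceT => z; exact: cchi.
exists K; split=> // V Vx0.
have V'x0 : nbhs x0 (V `&` ball x0 (r / 4)).
  by apply: filterI => //; apply: nbhsx_ballx; lra.
have [gam gam0 gamP] := perturbed_strict_max cK (cB _ _ cu cpsi)
  (nbhs_singleton Kx0) V'x0 (fun y Ky => (rball y (KO y Ky)).2).
exists (gam / 2) => [|chi cchi chipsi]; first by lra.
near=> j.
have uj : forall y, K y -> `|u_ j y - u y| <= gam / 2.
  by near: j; apply: near_uniform_le; [exact: u_u K cK KOmega|lra].
have epsr : eps_ j < r / 4.
  by near: j; apply: (cvgr_lt _ epscvg); lra.
have [|x [Kx [Vx xr] xmax]] := gamP _ (cB _ _ (cu_ j) cchi).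
  move=> y Ky; have := uj y Ky; have := chipsi y Ky.
  by rewrite !ler_norml => /andP[? ?] /andP[? ?]; apply/andP; split; lra.
exists x; split=> // C chiC.
have xx0 : `|x - x0| < r / 4 by move: xr; rewrite -ball_normE /= distrC.
have ballK y : closed_eball x (eps_ j) y -> K y.
  rewrite /closed_eball /K /closed_ball_/= => yx.
  rewrite distrC -(subrK x y) -addrA (le_trans (ler_normD _ _))//.
  have := norm_le_enorm (y - x); lra.
(* [x] is in the inner set: boundary points of the open set [Omega] lie outside
   [Omega], hence at distance at least [r] from [x0] *)
apply: (le_trans _ (subu_ j x _)); last first.
  split; first exact: (KOmega x Kx).
  apply: (@lt_le_trans _ _ (r / 4)%:E); first by rewrite lte_fin.
  apply/ereal_infP => _ [y [_ yO] <-].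
  rewrite lee_fin (le_trans _ (norm_le_enorm _))// leNgt; apply/negP => xy.
  apply: yO; apply: open_nbhs_nbhs; split=> //; apply: (rball y _).1.
  rewrite -ball_normE /= -(subrK x x0) -addrA (le_lt_trans (ler_normD _ _))//.
  by rewrite (distrC x0); lra.
rewrite lerN2.
have [m mK mmin] : exists2 m, K m & forall y, K y -> u_ j m <= u_ j y.
  have [|m mK mmin] := compact_EVT_min _ cK (cuK _ (cu_ j)).
    by exists x0; exact: nbhs_singleton.
  by exists m; [exact: set_mem|move=> y Ky; apply: mmin; exact: mem_set].
apply: (@fd_inf_laplacian_le _ _ _ chi _ _ _ (u_ j m)) => //.
  by move=> y /ballK; exact: mmin.
by move=> y /ballK; exact: xmax.
Unshelve. all: by end_near. Qed.

Lemma convex_paraboloid_test lam x0 : 0 <= lam -> Omega x0 ->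
  strict_local_max (fun y => u y - paraboloid lam x0 y) x0 -> - lam <= f x0.
Proof.
move=> lam0 Ox0 umax; apply/ler_addgt0Pr => delta delta0.
have [K [_ _ _ Ktest]] := perturbed_test_point Ox0 (paraboloid_continuous _ _) umax.
have [|gam gam0 gamP] := Ktest [set x | f x < f x0 + delta].
  by apply: (cvgr_lt _ (within_open_continuous_at oOmega cf Ox0)); rewrite ltrDl.
have [|y _|j [x [_ fx _ test]]] := filter_ex (gamP (paraboloid lam x0) _ _).
- exact: paraboloid_continuous.
- by rewrite subrr normr0 ltW.
rewrite (le_trans (test lam _) (ltW fx))//.
exact: two_point_bound_convex_paraboloid.
Qed.

(** The unit vector [d] is only a direction in which to move the vertex; it
    excludes dimension 0, where every point is a strict local maximum and the
    conclusion can fail. *)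
Lemma concave_paraboloid_test lam x0 d : lam < 0 -> enorm d = 1 -> Omega x0 ->
  strict_local_max (fun y => u y - paraboloid lam x0 y) x0 -> - lam <= f x0.
Proof.
move=> lam0 d1 Ox0 umax; rewrite leNgt; apply/negP => fx0.
have [K [Kx0 cK KOmega Ktest]] :=
  perturbed_test_point Ox0 (paraboloid_continuous _ _) umax.
have [|gam gam0 gamP] := Ktest [set x | f x < - lam].
  exact: (cvgr_lt _ (within_open_continuous_at oOmega cf Ox0)).
have [B KB] : exists B : R, forall y, K y -> `|dotp d (y - x0)| <= B.
  have [||c _ cmax] := @compact_EVT_max _ _ (fun y => `|dotp d (y - x0)|) _ _ cK.
  - by exists x0; exact: nbhs_singleton.
  - apply: continuous_subspaceT => y.
    apply: (@continuous_comp _ _ _ (fun y => dotp d (y - x0)) Num.norm).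
      apply: continuous_coordwise_dotp => i; first exact: cst_continuous.
      exact: continuous_coordB.
    exact: norm_continuous.
  - by exists `|dotp d (c - x0)| => y Ky; apply: cmax; exact: mem_set.
have B0 : 0 <= B.
  by rewrite (le_trans _ (KB x0 (nbhs_singleton Kx0))).
have [r r0 rP] : exists2 r : R, 0 < r & forall y, ball x0 r y ->
    K y /\ (y <> x0 -> u y - paraboloid lam x0 y < u x0 - paraboloid lam x0 x0).
  have : \forall y \near x0, K y /\
      (y <> x0 -> u y - paraboloid lam x0 y < u x0 - paraboloid lam x0 x0).
    near=> y; split; first by near: y.
    move=> yx0; have : y != x0 by apply/eqP.
    by near: y; exact: umax.
  by move=> /nbhs_ballP[r r0 rP]; exists r.
(* [z = x0 + t d] will be the new vertex; the last condition keeps the two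
   paraboloids within [gam] of each other on [K] *)
have [t [t0 tr t1 tgam]] :
    exists t : R, [/\ 0 < t, t < r, t < 1 & - lam * (t * (B + 1)) < gam].
  near (0 : R)^'+ => t.
  exists t; split.
  - by near: t; exact: nbhs_right_gt.
  - by near: t; exact: nbhs_right_lt.
  - by near: t; exact: nbhs_right_lt.
  - rewrite mulrA -ltr_pdivlMr ?ltr_wpDl// mulrC -ltr_pdivlMr ?oppr_gt0//.
    near: t; apply: nbhs_right_lt.
    by rewrite !divr_gt0// ?oppr_gt0// ltr_wpDl.
pose z := x0 + t *: d.
have zx0 : z - x0 = t *: d by rewrite /z addrC addKr.
have nzx0 : enorm (z - x0) = t by rewrite zx0 enormZ d1 mulr1 gtr0_norm.
have [Kz uz] : K z /\ u z < u x0.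
  have [|Kz uz] := rP z.
    by rewrite -ball_normE /= distrC (le_lt_trans (norm_le_enorm _))// nzx0.
  split=> //; have : z <> x0.
    by move=> zE; move: t0; rewrite -nzx0 zE subrr enorm0 ltxx.
  move=> /uz; rewrite paraboloid_center /paraboloid nzx0.
  have : lam * t ^+ 2 < 0 by rewrite nmulr_rlt0// exprn_gt0.
  lra.
have close y : K y -> `|paraboloid lam z y - paraboloid lam x0 y| <= gam.
  move=> /KB; set D := dotp d (y - x0) => DB.
  have -> : paraboloid lam z y - paraboloid lam x0 y =
      - lam * (t * D - t ^+ 2 / 2).
    rewrite /paraboloid !sqr_enorm.
    have -> : y - z = (y - x0) - t *: d by rewrite /z opprD addrA.
    rewrite /D; move: (y - x0) => w; rewrite !dotpE (dotpC w d).
    by rewrite -(sqr_enorm d) d1; field.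
  rewrite normrM gtr0_norm ?oppr_gt0// (le_trans _ (ltW tgam))//.
  rewrite ler_pM2l ?oppr_gt0//.
  have tt : t ^+ 2 <= t by rewrite expr2 ger_pMr// ltW.
  have tB : t * `|D| <= t * B by rewrite ler_pM2l.
  rewrite (le_trans (ler_normB _ _))// normrM (gtr0_norm t0).
  rewrite (@ger0_norm _ (t ^+ 2 / 2)) ?divr_ge0 ?sqr_ge0//.
  lra.
(* the amount by which the moved paraboloid forces [u z] above [u x0] *)
pose a := - lam / 2 * t ^+ 2.
have a0 : 0 < a by rewrite mulr_gt0 ?exprn_gt0// divr_gt0// oppr_gt0.
have [s s0 sP] : exists2 s : R, 0 < s & forall y, ball z s y -> u y < u x0.
  have : \forall y \near z, u y < u x0.
    exact: (cvgr_lt _ (within_open_continuous_at oOmega cu (KOmega _ Kz))).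
  by move=> /nbhs_ballP[s s0 sP]; exists s.
have : \forall j \near \oo, False.
  near=> j.
  have [x [Kx fx xmax test]] : exists x, [/\ K x, f x < - lam,
      forall y, K y -> u_ j y - paraboloid lam z y <= u_ j x - paraboloid lam z x &
      forall C, two_point_bound (paraboloid lam z) x (eps_ j) C -> - C <= f x].
    by near: j; exact: (gamP _ (paraboloid_continuous lam z)).
  (* otherwise the discrete operator is at most [lam] at [x], so [- lam <= f x] *)
  have xz : enorm (x - z) < eps_ j.
    rewrite ltNge; apply/negP => /(two_point_bound_concave_paraboloid _ _ _ _ lam0 (eps0 j)).
    by move=> /test; rewrite leNgt fx.
  have epss : eps_ j < s by near: j; exact: (cvgr_lt _ epscvg).
  have epst : eps_ j < t / 2.
    by near: j; apply: (cvgr_lt _ epscvg); rewrite divr_gt0.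
  have uj : forall y, K y -> `|u_ j y - u y| <= a / 4.
    near: j; apply: near_uniform_le; first exact: (u_u K cK KOmega).
    by rewrite divr_gt0.
  have ux : u x < u x0.
    by apply: sP; rewrite -ball_normE /= distrC (le_lt_trans (norm_le_enorm _))//
      (lt_trans xz).
  have := xmax x0 (nbhs_singleton Kx0).
  rewrite {1}/paraboloid enormB nzx0.
  have px : - paraboloid lam z x <= a / 4.
    have h : enorm (x - z) ^+ 2 <= (t / 2) ^+ 2.
      by rewrite ler_sqr ?nnegrE ?enorm_ge0 ?divr_ge0 ?ltW// (lt_trans xz).
    have l0 : 0 <= - lam by rewrite oppr_ge0 ltW.
    have := ler_wpM2l l0 h.
    by rewrite /paraboloid /a; lra.
  have := uj _ Kx; have := uj x0 (nbhs_singleton Kx0).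
  rewrite !ler_norml => /andP[? ?] /andP[? ?].
  have : lam / 2 * t ^+ 2 = - a by rewrite /a; lra.
  lra.
by move=> /filter_ex[].
Unshelve. all: by end_near. Qed.

(** Near [x0] the gradient stays away from 0, so the error term of
    [two_point_bound_taylor] tends to 0 with [eps_ j], and the normalized
    quadratic form of the gradient is continuous at [x0]. *)
Lemma regular_point_test phi x0 : poly_deg_le2 phi -> Omega x0 ->
  strict_local_max (fun y => u y - phi y) x0 -> gradient phi x0 != 0 ->
  - ((enorm (gradient phi x0) ^+ 2)^-1 *
      quad_form (hessian phi x0) (gradient phi x0)) <= f x0.
Proof.
move=> /poly_deg_le2_taylor[b [H [gradE hessE taylor]]] Ox0 umax.
rewrite gradE hessE => g0.
pose g x := b + x *m H.
have cg i : continuous (fun x => g x 0 i).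
  move=> x; under eq_fun do rewrite /g mxE.
  apply: (@continuousD _ _ _ (fun=> b 0 i) (fun y => (y *m H) 0 i)).
    exact: cst_continuous.
  by apply: continuous_coordwise_mulmx => k; exact: coord_continuous.
have cphi : continuous phi.
  have -> : phi = (fun x => phi 0 + dotp (b + 0 *m H) x + 2^-1 * quad_form H x).
    by apply/funext => x; rewrite -taylor add0r.
  move=> x.
  apply: (@continuousD _ _ _ (fun x => phi 0 + dotp (b + 0 *m H) x)
     (fun x => 2^-1 * quad_form H x)).
    apply: (@continuousD _ _ _ (fun=> phi 0) (fun x => dotp (b + 0 *m H) x)).
      exact: cst_continuous.
    by apply: continuous_coordwise_dotp => i; [exact: cst_continuous|exact: coord_continuous].
  apply: (@continuousM _ _ (fun=> 2^-1) (fun x => quad_form H x)).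
    exact: cst_continuous.
  apply: continuous_coordwise_dotp => i; last exact: coord_continuous.
  by apply: continuous_coordwise_mulmx => k; exact: coord_continuous.
pose F x := (enorm (g x) ^+ 2)^-1 * quad_form H (g x).
have cF : {for x0, continuous F}.
  apply: (@continuousM _ _ (fun x => (enorm (g x) ^+ 2)^-1) (fun x => quad_form H (g x))).
    apply: (@continuousV _ _ (fun x => enorm (g x) ^+ 2)).
      by rewrite expf_neq0// enorm_eq0.
    apply: (@continuous_comp _ _ _ (fun x => enorm (g x)) (fun t : R => t ^+ 2)).
      exact: continuous_coordwise_enorm.
    exact: exprn_continuous.
  apply: continuous_coordwise_dotp => // i.
  exact: continuous_coordwise_mulmx.
pose m := enorm (g x0) / 2.
have gx0 : 0 < enorm (g x0) by rewrite enorm_gt0.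
have m0 : 0 < m by rewrite divr_gt0.
pose M := \sum_i \sum_j `|H i j|.
rewrite -/(g x0) -/(F x0); apply/ler_addgt0Pr => delta delta0.
have [K [_ _ _ Ktest]] := perturbed_test_point Ox0 cphi umax.
have d3 : 0 < delta / 3 by rewrite divr_gt0.
have [|gam gam0 gamP] :=
  Ktest [set x | [/\ m < enorm (g x), F x < F x0 + delta / 3 & f x < f x0 + delta / 3]].
  have V1 : \forall x \near x0, m < enorm (g x).
    apply: (cvgr_gt _ (continuous_coordwise_enorm _ _ cg x0)).
    by rewrite /m; lra.
  have V2 : \forall x \near x0, F x < F x0 + delta / 3.
    by apply: (cvgr_lt _ cF); rewrite ltrDl.
  have V3 : \forall x \near x0, f x < f x0 + delta / 3.
    by apply: (cvgr_lt _ (within_open_continuous_at oOmega cf Ox0)); rewrite ltrDl.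
  by near=> x; split; near: x.
have c0 : 0 <= M ^+ 2 / (2 * m) by rewrite divr_ge0 ?sqr_ge0 ?mulr_ge0// ltW.
have epsM : \forall j \near \oo, M ^+ 2 / (2 * m) * eps_ j < delta / 3.
  have : \forall j \near \oo, eps_ j < delta / 3 / (M ^+ 2 / (2 * m) + 1).
    by apply: (cvgr_lt _ epscvg); rewrite divr_gt0// ltr_wpDl.
  apply: filterS => j; rewrite ltr_pdivlMr ?ltr_wpDl//.
  have := eps0 j; lra.
have close y : K y -> `|phi y - phi y| <= gam by rewrite subrr normr0 ltW.
have [j [[x [_ [gx Fx fx] _ test]] epsj]] := filter_ex (filterI (gamP _ cphi close) epsM).
have gx_neq0 : g x != 0 by rewrite -enorm_gt0 (lt_trans m0).
have := test _ (two_point_bound_taylor _ _ _ _ _ (eps0 j) gx_neq0 (taylor x)).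
rewrite -/(F x) -/M.
have : M ^+ 2 / (2 * enorm (g x)) * eps_ j <= M ^+ 2 / (2 * m) * eps_ j.
  rewrite ler_pM2r// ler_wpM2l ?sqr_ge0// lef_pV2 ?posrE ?mulr_gt0//.
    by rewrite ler_pM2l// ltW.
  exact: lt_trans gx.
lra.
Unshelve. all: by end_near. Qed.

(** When the gradient vanishes, [phi] can be replaced by the paraboloid of
    opening [lam], which touches [u] from above at [x0] as well.  If [lam < 0],
    the set of values of the form on the sphere cannot be empty ([sup set0] is
    0), and any point of the sphere gives a direction in which to move the
    vertex. *)
Lemma degenerate_point_test phi x0 : poly_deg_le2 phi -> Omega x0 ->
  strict_local_max (fun y => u y - phi y) x0 -> gradient phi x0 = 0 ->
  - sup [set quad_form (hessian phi x0) v | v in [set v | enorm v = 1]] <= f x0.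
Proof.
move=> /poly_deg_le2_taylor[b [H [gradE hessE taylor]]] Ox0 umax.
rewrite gradE hessE => g0.
set S := [set quad_form H v | v in _]; set lam := sup S.
have S_ub : has_ubound S.
  exists (\sum_i \sum_j `|H i j|) => _ [v /= v1 <-].
  by have := quad_form_le H v; rewrite v1 expr1n mulr1.
have lamP w : quad_form H w <= lam * enorm w ^+ 2.
  have [->|w0] := eqVneq w 0.
    by rewrite enorm0 expr0n mulr0 /quad_form dotp0r.
  have nw0 : 0 < enorm w by rewrite enorm_gt0.
  have wE : w = enorm w *: ((enorm w)^-1 *: w).
    by rewrite scalerA divff ?scale1r// gt_eqF.
  rewrite {1}wE quad_formZ mulrC ler_pM2r ?exprn_gt0//.
  by apply: ub_le_sup => //; exists ((enorm w)^-1 *: w) => //; exact: enorm_normalize.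
have umax' : strict_local_max (fun y => u y - paraboloid lam x0 y) x0.
  apply: filterS umax => y uy.
  rewrite paraboloid_center subr0.
  have := taylor x0 (y - x0); rewrite g0 dotpC dotp0r addr0 addrC subrK => phiy.
  have := lamP (y - x0); rewrite /paraboloid; move: uy; rewrite phiy; lra.
have [lam0|lam0] := leP 0 lam; first exact: convex_paraboloid_test.
have [S0|/set0P[_ [d d1 _]]] := eqVneq S set0.
  by move: lam0; rewrite /lam S0 sup0 ltxx.
exact: concave_paraboloid_test lam0 d1 Ox0 umax'.
Qed.

End stability.

Theorem theorem2p11 (R : realType) (n : nat) (Omega : set 'rV[R]_n)
    (Omega_open : open Omega) (Omega_connected : connected Omega)
    (Omega_bounded : bounded_set Omega)
    (Omega_path_diam : (path_diam (closure Omega) < +oo)%E)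
    (f : 'rV[R]_n -> R) (f_cont : {within Omega, continuous f})
    (eps_ : nat -> R) (eps_gt0 : forall j, 0 < eps_ j)
    (eps_cvg0 : eps_ @ \oo --> (0 : R))
    (u_ : nat -> 'rV[R]_n -> R)
    (u_cont_j : forall j, {within Omega, continuous (u_ j)})
    (u_sub_j : forall j x, inner_set Omega (eps_ j) x ->
       - fd_inf_laplacian (eps_ j) (u_ j) x <= f x)
    (u : 'rV[R]_n -> R) (u_cont : {within Omega, continuous u})
    (u_cvg : cvg_locally_uniformly Omega u_ u) :
  viscosity_subsolution Omega u f.
Proof.
split=> [x Ox a uxa|phi x0 phi2 Ox0 umax].
  apply: cvg_within.
  by apply: (cvgr_lt _ (within_open_continuous_at Omega_open u_cont Ox)).
rewrite /inf_laplacian_plus; case: ifPn => [g0|/negPn/eqP g0].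
  exact: (regular_point_test Omega_open f_cont eps_gt0 eps_cvg0 u_cont_j u_sub_j u_cont).
exact: (degenerate_point_test Omega_open f_cont eps_gt0 eps_cvg0 u_cont_j u_sub_j u_cont).
Qed.
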